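(* Let $\mathcal X$ and $\mathcal Y$ be the transformations of solutions of the constant astigmatism equation $z_{yy}+(1/z)_{xx}+2=0$ defined in the context. Under a suitable choice of integration constants (in the potentials $\eta$, resp. $\xi$, of the original and of the transformed solution), $\mathcal X\circ\mathcal X=\mathrm{Id}$ and $\mathcal Y\circ\mathcal Y=\mathrm{Id}$.
   Context: Let $z(x,y)>0$ be a smooth solution of $z_{yy}+(1/z)_{xx}+2=0$ on a simply connected open set. Its potentials $\eta,\xi$ are functions, unique up to additive constants, satisfying $$\eta_x = x z_y,\quad \eta_y = x\frac{z_x}{z^2}+\frac1z-x^2,\qquad \xi_x=-y z_y+z-y^2,\quad \xi_y=-y\frac{z_x}{z^2}.$$ The transformation $\mathcal X(x,y,z)=(x',y',z')$ is given by $$x'=\frac{xz}{x^2z+1},\qquad y'=\eta,\qquad z'=\frac{(x^2z+1)^2}{z},$$ and $\mathcal Y(x,y,z)=(x^*,y^*,z^* )$ by $$x^*=\xi,\qquad y^*=\frac{y}{y^2+z},\qquad z^*=\frac{z}{(y^2+z)^2}.$$ On domains where $(x',y')$ (resp. $(x^*,y^* )$) are local coordinates, $z'(x',y')$ (resp. $z^*(x^*,y^* )$) is again a solution of the constant astigmatism equation, so the transformation can be applied again, using the potential $\eta'$ (resp. $\xi^*$) of the transformed solution with respect to its own independent variables. Thus $\mathcal X\circ\mathcal X=\mathrm{Id}$ means: $x'z'/(x'^2z'+1)=x$, $\eta'=y$ and $(x'^2z'+1)^2/z'=z$, and analogously for $\mathcal Y$. Throughout one works on domains where $(x',y')$ (resp.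 $(x^*,y^* )$) are local coordinates. *)

(* Defs.v *)
From HB Require Import structures.
From mathcomp Require Import all_boot all_order all_algebra.
From mathcomp Require Import all_classical all_reals all_analysis.

Set Implicit Arguments.
Unset Strict Implicit.
Unset Printing Implicit Defensive.

Import Order.TTheory GRing.Theory Num.Theory.
Import numFieldNormedType.Exports.

Local Open Scope classical_set_scope.
Local Open Scope ring_scope.

(* Functions on an open set U of the plane are total functions on R * R whose
   values outside U are irrelevant. *)

(* C^oo on an open set: every iterated directional derivative, including the
   function itself, is Frechet differentiable at every point of U. *)
Definition smooth_on (R : realType) (V W : normedModType R) (U : set V)
    (f : V -> W) : Prop :=
  forall (s : seq V) (p : V), U p ->
    differentiable (foldr (fun v g => 'D_v g) f s) p.

Definition e_x (R : realType) : R * R := (1, 0).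
Definition e_y (R : realType) : R * R := (0, 1).
Arguments e_x {R}.
Arguments e_y {R}.

(* Path connected, and every loop is null-homotopic relative to its base
   point; in the homotopy H the first argument is the deformation parameter. *)
Definition simply_connected (R : realType) (T : topologicalType)
    (U : set T) : Prop :=
  (forall p q : T, U p -> U q -> exists c : R -> T,
     [/\ {within `[0, 1]%classic, continuous c}, c 0 = p, c 1 = q &
         forall t, 0 <= t <= 1 -> U (c t)]) /\
  (forall c : R -> T,
     {within `[0, 1]%classic, continuous c} -> c 0 = c 1 ->
     (forall t, 0 <= t <= 1 -> U (c t)) ->
     exists H : R * R -> T,
       [/\ {within `[0, 1]%classic `*` `[0, 1]%classic, continuous H},
           forall t, 0 <= t <= 1 -> H (0, t) = c t,
           forall t, 0 <= t <= 1 -> H (1, t) = c 0,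
           forall s, 0 <= s <= 1 -> H (s, 0) = c 0 /\ H (s, 1) = c 0 &
           forall s t, 0 <= s <= 1 -> 0 <= t <= 1 -> U (H (s, t))]).

(* Smooth positive solution of z_yy + (1/z)_xx + 2 = 0 on U. *)
Definition CA_solution (R : realType) (U : set (R * R)) (z : R * R -> R) :
    Prop :=
  [/\ smooth_on U z,
      forall p, U p -> 0 < z p &
      forall p, U p ->
        'D_e_y ('D_e_y z) p + 'D_e_x ('D_e_x (fun q => (z q)^-1)) p + 2 = 0].

Definition potential_eta (R : realType) (U : set (R * R))
    (z eta : R * R -> R) : Prop :=
  forall p, U p ->
    is_derive p e_x eta (p.1 * 'D_e_y z p) /\
    is_derive p e_y eta
      (p.1 * ('D_e_x z p / z p ^+ 2) + (z p)^-1 - p.1 ^+ 2).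

Definition potential_xi (R : realType) (U : set (R * R))
    (z xi : R * R -> R) : Prop :=
  forall p, U p ->
    is_derive p e_x xi (- p.2 * 'D_e_y z p + z p - p.2 ^+ 2) /\
    is_derive p e_y xi (- p.2 * ('D_e_x z p / z p ^+ 2)).

(* The point ((x', y'), z') obtained from ((x, y), z (x, y)), as a function
   of (x, y), for a given choice of the potential. *)
Definition calX (R : realType) (z eta : R * R -> R) (p : R * R) :
    (R * R) * R :=
  ((p.1 * z p / (p.1 ^+ 2 * z p + 1), eta p),
   (p.1 ^+ 2 * z p + 1) ^+ 2 / z p).

Definition calY (R : realType) (z xi : R * R -> R) (p : R * R) :
    (R * R) * R :=
  ((xi p, p.2 / (p.2 ^+ 2 + z p)),
   z p / (p.2 ^+ 2 + z p) ^+ 2).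

(* The components of phi are coordinates on D with range V: phi is a
   diffeomorphism from the open set D onto the open set V. *)
Definition coordinates_on (R : realType) (D V : set (R * R))
    (phi : R * R -> R * R) : Prop :=
  [/\ open D, open V, set_bij D V phi, smooth_on D phi &
      exists psi : R * R -> R * R,
        smooth_on V psi /\ (forall p, D p -> psi (phi p) = p)].

(* T sends each (x, y) in D to a point of the graph of a function w of the new
   coordinates on V, so w is determined on V. *)
Definition transformed (R : realType) (D : set (R * R))
    (T : R * R -> (R * R) * R) (V : set (R * R)) (w : R * R -> R) : Prop :=
  coordinates_on D V (fun p => (T p).1) /\
  (forall p, D p -> w (T p).1 = (T p).2).

(* Main.v *)
Require Import Defs.
From HB Require Import structures.
From mathcomp Require Import all_boot all_order all_algebra.
From mathcomp Require Import all_classical all_reals all_analysis.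
From mathcomp Require Import ring.

Set Implicit Arguments.
Unset Strict Implicit.
Unset Printing Implicit Defensive.

Import Order.TTheory GRing.Theory Num.Theory.
Import numFieldNormedType.Exports.

Local Open Scope classical_set_scope.
Local Open Scope ring_scope.

(* Along the graph of z, the pointwise parts of X and Y are involutive by
   algebra.  The potential of the transformed solution that makes the remaining
   coordinate involutive is the original y (for X), resp. x (for Y), read as a
   function of the new coordinates: its partial derivatives and those of the
   transformed solution are given by Cramer's rule from the Jacobian of the
   coordinate change, and the potential equations become identities between
   rational functions of x, y, z, z_x and z_y. *)

(** * Differential calculus of projections, quotients and functions on the plane *)

Lemma differentiable_fst (R : realType) (p : R * R) :
  differentiable (fst : R * R -> R) p.
Proof. by apply: linear_differentiable => q; exact: cvg_fst. Qed.

Lemma differentiable_snd (R : realType) (p : R * R) :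
  differentiable (snd : R * R -> R) p.
Proof. by apply: linear_differentiable => q; exact: cvg_snd. Qed.

Lemma is_derive_fst (R : realType) (p v : R * R) :
  is_derive p v (fst : R * R -> R) v.1.
Proof.
have dp := differentiable_fst p.
apply: DeriveDef; first exact: diff_derivable.
by rewrite deriveE // diff_lin // => q; exact: cvg_fst.
Qed.

Lemma is_derive_snd (R : realType) (p v : R * R) :
  is_derive p v (snd : R * R -> R) v.2.
Proof.
have dp := differentiable_snd p.
apply: DeriveDef; first exact: diff_derivable.
by rewrite deriveE // diff_lin // => q; exact: cvg_snd.
Qed.

Lemma is_derive_div (R : realType) (V : normedModType R) (f g : V -> R)
    (p v : V) (df dg : R) :
  is_derive p v f df -> is_derive p v g dg -> g p != 0 ->
  is_derive p v (fun q => f q / g q) ((df * g p - f p * dg) / g p ^+ 2).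
Proof.
move=> hf [hg <-] g0.
have hV : is_derive p v (fun q => (g q)^-1) (- (g p) ^- 2 *: 'D_v g p).
  by apply: DeriveDef; [exact: derivableV | exact: deriveV].
have -> : (fun q => f q / g q) = f * (fun q => (g q)^-1) by [].
apply: is_derive_eq.
by rewrite /GRing.scale /=; field.
Qed.

Lemma smooth_on_differentiable (R : realType) (V W : normedModType R)
    (U : set V) (f : V -> W) (p : V) :
  smooth_on U f -> U p -> differentiable f p.
Proof. by move=> sf; exact: sf [::] p. Qed.

Lemma derive_partial (R : realType) (f : R * R -> R) (p v : R * R) :
  differentiable f p -> 'D_v f p = v.1 * 'D_e_x f p + v.2 * 'D_e_y f p.
Proof.
move=> df; rewrite !deriveE //.
have {1}-> : v = v.1 *: e_x + v.2 *: e_y.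
  by case: v => a b; congr (_, _) => /=; rewrite /GRing.scale /=; ring.
by rewrite linearD !linearZ.
Qed.

(** * Derivatives in the new coordinates *)

Section coordinates.
Context {R : realType} {D V : set (R * R)} {phi : R * R -> R * R}.
Hypothesis cphi : coordinates_on D V phi.

Let f q := (phi q).1.
Let g q := (phi q).2.

(** Surjectivity of [phi] onto [V] makes the given left inverse two-sided. *)
Lemma coordinates_inverse : exists psi : R * R -> R * R,
  (forall p, D p -> psi (phi p) = p) /\
  (forall q, V q -> D (psi q) /\ phi (psi q) = q).
Proof.
have [_ _ [_ _ sur] _ [psi [_ psiK]]] := cphi.
exists psi; split=> // q /sur [p Dp <-].
by rewrite psiK.
Qed.

(** The coefficients are the components of ['d psi (phi p) v]. They are chosen before [F] and [G],
    so they can later be identified by testing on the coordinate functions. *)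
Lemma coordinates_chain p v : D p -> exists a b : R,
  forall F G : R * R -> R, differentiable F p ->
    (forall q, D q -> G (phi q) = F q) ->
    is_derive (phi p) v G (a * 'D_e_x F p + b * 'D_e_y F p).
Proof.
have [_ oV [maps _ sur] _ [psi [spsi psiK]]] := cphi.
move=> Dp; have Vp : V (phi p) by exact: maps.
have dpsi := smooth_on_differentiable spsi Vp.
set u := 'd psi (phi p) v.
exists u.1, u.2 => F G dF GF.
have dF' : differentiable F (psi (phi p)) by rewrite psiK.
(* [G] is known only on [V], but [V] is a neighbourhood of [phi p], which suffices for a derivative
   there. *)
apply: (near_eq_is_derive (f := F \o psi)).
  apply: filterS (open_nbhs_nbhs (conj oV Vp)) => q /sur [p' Dp' <-] /=.
  by rewrite psiK // GF.
apply: DeriveDef; first exact/diff_derivable/differentiable_comp.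
rewrite deriveE; last exact: differentiable_comp.
by rewrite diff_comp //= psiK // -deriveE // derive_partial.
Qed.

(** The chain coefficients form the inverse of the Jacobian matrix of [phi]. The determinant [J] is
    a variable with a defining equation, so that later computations may keep it opaque or expand
    it. *)
Lemma coordinates_cramer p : D p -> exists2 J : R,
  J = 'D_e_x f p * 'D_e_y g p - 'D_e_y f p * 'D_e_x g p &
  J != 0 /\ forall F G : R * R -> R, differentiable F p ->
    (forall q, D q -> G (phi q) = F q) ->
    is_derive (phi p) e_x G
      (('D_e_y g p * 'D_e_x F p - 'D_e_x g p * 'D_e_y F p) / J) /\
    is_derive (phi p) e_y G
      (('D_e_x f p * 'D_e_y F p - 'D_e_y f p * 'D_e_x F p) / J).
Proof.
move=> Dp; have [_ _ _ sphi _] := cphi.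
have dphi := smooth_on_differentiable sphi Dp.
have df : differentiable f p.
  exact: (differentiable_comp dphi (differentiable_fst _)).
have dg : differentiable g p.
  exact: (differentiable_comp dphi (differentiable_snd _)).
have [a [b hx]] := coordinates_chain e_x Dp.
have [c [d hy]] := coordinates_chain e_y Dp.
have val (F : R * R -> R) (v : R * R) (l m : R) :
    is_derive (phi p) v F l -> is_derive (phi p) v F m -> l = m.
  by move=> [_ <-] [_ <-].
(* In the new coordinates [f] and [g] are the projections, whose derivatives are 0 or 1; this gives
   four linear equations for [a], [b], [c], [d]. *)
have af := val _ _ _ _ (hx f fst df (fun=> fun=> erefl)) (is_derive_fst _ _).
have bg := val _ _ _ _ (hx g snd dg (fun=> fun=> erefl)) (is_derive_snd _ _).
have cf := val _ _ _ _ (hy f fst df (fun=> fun=> erefl)) (is_derive_fst _ _).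
have dg' := val _ _ _ _ (hy g snd dg (fun=> fun=> erefl)) (is_derive_snd _ _).
move: af bg cf dg' => /=.
move: ('D_e_x f p) ('D_e_y f p) ('D_e_x g p) ('D_e_y g p) => fx fy gx gy.
move=> af bg cf dg'.
have J0 : fx * gy - fy * gx != 0.
  (* Determinants of inverse matrices multiply to 1. *)
  have : (a * d - b * c) * (fx * gy - fy * gx) = 1.
    transitivity ((a * fx + b * fy) * (c * gx + d * gy) -
                  (c * fx + d * fy) * (a * gx + b * gy)); first by ring.
    by rewrite af bg cf dg'; ring.
  by move=> e; apply/eqP => J0; move/eqP: e; rewrite J0 mulr0 eq_sym oner_eq0.
exists (fx * gy - fy * gx) => //; split=> // F G dF GF; split.
(* Multiplying the two equations for [a], [b] by [gy] and [fy] and subtracting eliminates [b]; the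
   other coefficients are found likewise. *)
- have aE : a = gy / (fx * gy - fy * gx).
    apply: (mulIf J0); rewrite divfK //.
    transitivity ((a * fx + b * fy) * gy - fy * (a * gx + b * gy)); first by ring.
    by rewrite af bg; ring.
  have bE : b = - gx / (fx * gy - fy * gx).
    apply: (mulIf J0); rewrite divfK //.
    transitivity (fx * (a * gx + b * gy) - (a * fx + b * fy) * gx); first by ring.
    by rewrite af bg; ring.
  by have := hx F G dF GF; rewrite aE bE => h; apply: is_derive_eq h _; field.
- have cE : c = - fy / (fx * gy - fy * gx).
    apply: (mulIf J0); rewrite divfK //.
    transitivity ((c * fx + d * fy) * gy - fy * (c * gx + d * gy)); first by ring.
    by rewrite cf dg'; ring.
  have dE : d = fx / (fx * gy - fy * gx).
    apply: (mulIf J0); rewrite divfK //.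
    transitivity (fx * (c * gx + d * gy) - (c * fx + d * fy) * gx); first by ring.
    by rewrite cf dg'; ring.
  by have := hy F G dF GF; rewrite cE dE => h; apply: is_derive_eq h _; field.
Qed.

End coordinates.

(** * Pointwise calculus and algebra of the first transformation *)

Section calX.
Context {R : realType} {z : R * R -> R} (eta : R * R -> R) {p : R * R}.
Hypotheses (dz : differentiable z p) (z0 : 0 < z p).

Local Notation S := (fun q : R * R => q.1 ^+ 2 * z q + 1).

Lemma calX_denom_neq0 : p.1 ^+ 2 * z p + 1 != 0.
Proof. by rewrite gt_eqF // ltr_wpDl // mulr_ge0 ?sqr_ge0 ?ltW. Qed.

Lemma differentiable_calX_denom : differentiable S p.
Proof.
have -> : S = fst ^+ 2 * z + cst 1 by [].
apply: differentiableD => //; apply: differentiableM => //.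
exact/differentiableX/differentiable_fst.
Qed.

Lemma is_derive_calX_denom v :
  is_derive p v S (2 * p.1 * v.1 * z p + p.1 ^+ 2 * 'D_v z p).
Proof.
have -> : S = fst ^+ 2 * z + cst 1 by [].
have d1 := is_derive_fst p v.
have d2 : is_derive p v z ('D_v z p) by exact/derivableP/diff_derivable.
by apply: is_derive_eq; rewrite !fctE /GRing.scale /=; ring.
Qed.

(** The direction stays arbitrary so that one formula serves both [e_x] and [e_y]. *)
Lemma is_derive_calX11 v :
  is_derive p v (fun q => (calX z eta q).1.1)
    ((v.1 * z p + p.1 * 'D_v z p - p.1 ^+ 2 * z p ^+ 2 * v.1) /
     (p.1 ^+ 2 * z p + 1) ^+ 2).
Proof.
have d1 := is_derive_fst p v.
have d2 : is_derive p v z ('D_v z p) by exact/derivableP/diff_derivable.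
have dM : is_derive p v (fun q => q.1 * z q) (p.1 * 'D_v z p + z p * v.1).
  exact: is_deriveM.
have := is_derive_div dM (is_derive_calX_denom v) calX_denom_neq0.
move=> h; apply: is_derive_eq h _.
by field; exact: calX_denom_neq0.
Qed.

Lemma differentiable_calX2 : differentiable (fun q => (calX z eta q).2) p.
Proof.
have -> : (fun q => (calX z eta q).2) = S ^+ 2 * (fun q => (z q)^-1) by [].
apply: differentiableM; first exact/differentiableX/differentiable_calX_denom.
by apply: differentiableV => //; rewrite gt_eqF.
Qed.

Lemma is_derive_calX2 v :
  is_derive p v (fun q => (calX z eta q).2)
    ((p.1 ^+ 2 * z p + 1) * (4 * p.1 * z p ^+ 2 * v.1 +
      (p.1 ^+ 2 * z p - 1) * 'D_v z p) / z p ^+ 2).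
Proof.
have d2 : is_derive p v z ('D_v z p) by exact/derivableP/diff_derivable.
have dX := is_deriveX 2 (is_derive_calX_denom v).
have zn0 : z p != 0 by rewrite gt_eqF.
have h := is_derive_div dX d2 zn0.
apply: is_derive_eq h _; rewrite !fctE /GRing.scale /=.
by field.
Qed.

(** Since x'^2 z' = x^2 z, both applications have the same denominator, and it cancels. *)
Lemma calX_involutive (z' eta' : R * R -> R) :
  z' (calX z eta p).1 = (calX z eta p).2 -> eta' (calX z eta p).1 = p.2 ->
  calX z' eta' (calX z eta p).1 = (p, z p).
Proof.
move=> hz' heta'; rewrite {1}/calX hz' heta' /=.
have zn0 : z p != 0 by rewrite gt_eqF.
have S0 := calX_denom_neq0.
have -> : (p.1 * z p / (p.1 ^+ 2 * z p + 1)) ^+ 2 *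
    ((p.1 ^+ 2 * z p + 1) ^+ 2 / z p) + 1 = p.1 ^+ 2 * z p + 1.
  by field; rewrite ?S0 ?zn0.
transitivity ((p.1, p.2), z p); last by rewrite -surjective_pairing.
by congr ((_, _), _); field; rewrite ?S0 ?zn0.
Qed.

End calX.

(** * Pointwise calculus and algebra of the second transformation *)

Section calY.
Context {R : realType} {z : R * R -> R} (xi : R * R -> R) {p : R * R}.
Hypotheses (dz : differentiable z p) (z0 : 0 < z p).

Local Notation T := (fun q : R * R => q.2 ^+ 2 + z q).

Lemma calY_denom_neq0 : p.2 ^+ 2 + z p != 0.
Proof. by rewrite gt_eqF // ltr_wpDl // sqr_ge0. Qed.

Lemma differentiable_calY_denom : differentiable T p.
Proof.
have -> : T = snd ^+ 2 + z by [].
by apply: differentiableD => //; exact/differentiableX/differentiable_snd.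
Qed.

Lemma is_derive_calY_denom v : is_derive p v T (2 * p.2 * v.2 + 'D_v z p).
Proof.
have -> : T = snd ^+ 2 + z by [].
have d1 := is_derive_snd p v.
have d2 : is_derive p v z ('D_v z p) by exact/derivableP/diff_derivable.
by apply: is_derive_eq; rewrite /GRing.scale /=; ring.
Qed.

Lemma is_derive_calY12 v :
  is_derive p v (fun q => (calY z xi q).1.2)
    ((v.2 * (z p - p.2 ^+ 2) - p.2 * 'D_v z p) / (p.2 ^+ 2 + z p) ^+ 2).
Proof.
have d1 := is_derive_snd p v.
have h := is_derive_div d1 (is_derive_calY_denom v) calY_denom_neq0.
apply: is_derive_eq h _.
by field; exact: calY_denom_neq0.
Qed.

Lemma differentiable_calY2 : differentiable (fun q => (calY z xi q).2) p.
Proof.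
have -> : (fun q => (calY z xi q).2) = z * (fun q => ((T ^+ 2) q)^-1) by [].
apply: differentiableM => //; apply: differentiableV.
  exact/differentiableX/differentiable_calY_denom.
by rewrite !fctE expf_neq0 // calY_denom_neq0.
Qed.

Lemma is_derive_calY2 v :
  is_derive p v (fun q => (calY z xi q).2)
    (((p.2 ^+ 2 - z p) * 'D_v z p - 4 * p.2 * z p * v.2) /
     (p.2 ^+ 2 + z p) ^+ 3).
Proof.
have d2 : is_derive p v z ('D_v z p) by exact/derivableP/diff_derivable.
have dX := is_deriveX 2 (is_derive_calY_denom v).
have T0 : (T ^+ 2) p != 0 by rewrite !fctE expf_neq0 // calY_denom_neq0.
have h := is_derive_div d2 dX T0.
apply: is_derive_eq h _; rewrite !fctE /GRing.scale /=.
by field; exact: calY_denom_neq0.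
Qed.

(** The new denominator y*^2 + z* is the reciprocal of the old one, y^2 + z. *)
Lemma calY_involutive (zs xis : R * R -> R) :
  zs (calY z xi p).1 = (calY z xi p).2 -> xis (calY z xi p).1 = p.1 ->
  calY zs xis (calY z xi p).1 = (p, z p).
Proof.
move=> hzs hxis; rewrite {1}/calY hzs hxis /=.
have zn0 : z p != 0 by rewrite gt_eqF.
have T0 := calY_denom_neq0.
have -> : (p.2 / (p.2 ^+ 2 + z p)) ^+ 2 + z p / (p.2 ^+ 2 + z p) ^+ 2 =
    (p.2 ^+ 2 + z p)^-1 by field.
transitivity ((p.1, p.2), z p); last by rewrite -surjective_pairing.
by congr ((_, _), _); field; rewrite ?T0.
Qed.

End calY.

(** * Potential equations for the transformed solutions *)

Theorem proposition2 (R : realType) (U : set (R * R)) (z : R * R -> R)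
    (oU : open U) (scU : simply_connected R U) (zU : CA_solution U z) :
  (forall (eta : R * R -> R), potential_eta U z eta ->
   forall (D V : set (R * R)) (z' : R * R -> R),
     D `<=` U -> transformed D (calX z eta) V z' ->
     exists eta' : R * R -> R,
       potential_eta V z' eta' /\
       (forall p, D p -> calX z' eta' (calX z eta p).1 = (p, z p)))
  /\
  (forall (xi : R * R -> R), potential_xi U z xi ->
   forall (D V : set (R * R)) (zs : R * R -> R),
     D `<=` U -> transformed D (calY z xi) V zs ->
     exists xis : R * R -> R,
       potential_xi V zs xis /\
       (forall p, D p -> calY zs xis (calY z xi p).1 = (p, z p))).
Proof.
have [zsm zpos _] := zU.
(* Clears the Jacobian J without expanding it, so that [field] does not ask for
   its numerator to be nonzero. *)
have cramer_eq (J A B c k : R) : J != 0 ->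
    A = c * B + k * J -> A / J = c * (B / J) + k.
  by move=> J0 ->; rewrite mulrDl mulfK // mulrA.
split=> [eta he|xi hxi] D V w DU [cphi hw].
- have [psi [psiK VK]] := coordinates_inverse cphi.
  exists (fun q => (psi q).2); split=> [q Vq|p Dp]; last first.
    by apply: calX_involutive; rewrite ?hw ?psiK //; exact/zpos/DU.
  (* Every point of [V] is the image of some [p] in [D], so the equations are checked in terms of
     the old coordinates. *)
  have [Dp <-] := VK q Vq; move: (psi q) Dp => p Dp {q Vq}.
  have Up := DU _ Dp; have z0 := zpos _ Up.
  have zn0 : z p != 0 by rewrite gt_eqF.
  have S0 := calX_denom_neq0 z0.
  have dz := smooth_on_differentiable zsm Up.
  have [J JE [J0 cramer]] := coordinates_cramer cphi Dp.
  have [wx wy] := cramer _ w (differentiable_calX2 eta dz z0) hw.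
  have [yx yy] := cramer _ (fun q => (psi q).2) (differentiable_snd p)
    (fun q Dq => congr1 snd (psiK q Dq)).
  move: JE wx wy yx yy; rewrite hw //=.
  rewrite !(derive_val (is_derive := is_derive_snd p _)).
  rewrite !(derive_val (is_derive := is_derive_calX2 eta dz z0 _)).
  rewrite !(derive_val (is_derive := is_derive_calX11 eta dz z0 _)).
  have [ex ey] := he p Up.
  rewrite !(derive_val (is_derive := ex)) !(derive_val (is_derive := ey)) /=.
  move=> JE [_ ->] [_ ->] yx yy; split.
    (* Both sides of this equation carry the factor 1/[J], so the value of [J] does not enter. *)
    by apply: is_derive_eq yx _; field; rewrite ?J0 ?S0 ?zn0.
  (* The summand 1/z' - x'^2 lacks the factor 1/[J]. It is taken as [k], with [c] = x', and [J] is
     expanded only after it has been cleared. *)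
  apply: is_derive_eq yy _; rewrite -[RHS]addrA (mulrAC _ J^-1).
  apply: cramer_eq => //.
  by rewrite JE; field; rewrite ?S0 ?zn0.
- have [psi [psiK VK]] := coordinates_inverse cphi.
  exists (fun q => (psi q).1); split=> [q Vq|p Dp]; last first.
    by apply: calY_involutive; rewrite ?hw ?psiK //; exact/zpos/DU.
  have [Dp <-] := VK q Vq; move: (psi q) Dp => p Dp {q Vq}.
  have Up := DU _ Dp; have z0 := zpos _ Up.
  have zn0 : z p != 0 by rewrite gt_eqF.
  have T0 := calY_denom_neq0 z0.
  have dz := smooth_on_differentiable zsm Up.
  have [J JE [J0 cramer]] := coordinates_cramer cphi Dp.
  have [wx wy] := cramer _ w (differentiable_calY2 xi dz z0) hw.
  have [xx xy] := cramer _ (fun q => (psi q).1) (differentiable_fst p)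
    (fun q Dq => congr1 fst (psiK q Dq)).
  move: JE wx wy xx xy; rewrite hw //=.
  rewrite !(derive_val (is_derive := is_derive_fst p _)).
  rewrite !(derive_val (is_derive := is_derive_calY2 xi dz z0 _)).
  rewrite !(derive_val (is_derive := is_derive_calY12 xi dz z0 _)).
  have [ex ey] := hxi p Up.
  rewrite !(derive_val (is_derive := ex)) !(derive_val (is_derive := ey)) /=.
  move=> JE [_ ->] [_ ->] xx xy; split; last first.
    (* The roles are exchanged: [J] cancels in the y*-equation, while the x*-equation has [k] = z* -
       y*^2 and [c] = -y*. *)
    by apply: is_derive_eq xy _; field; rewrite ?J0 ?T0 ?zn0.
  apply: is_derive_eq xx _; rewrite -[RHS]addrA.
  apply: cramer_eq => //.
  by rewrite JE; field; rewrite ?T0 ?zn0.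
Qed.
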